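(* Let $n$ be a nonnegative integer and let $a,b,c$ be complex numbers such that no lower parameter of the series below is a nonpositive integer and all denominators below are nonzero. Then $$\frac{(c-a)_n(a-b+1)_n}{(c)_n(1-b)_n}={}_9F_8\left[\begin{matrix}-\frac n2,\ \frac{1-n}{2},\ 1+\frac{a-b}{3},\ a-b,\ c-a,\ a,\ 1-a,\ b+c-a,\ a-b-c+1\\ \frac12,\ \frac{a-b}{3},\ \frac{1-b}{2},\ \frac{2-b}{2},\ \frac c2,\ \frac{c+1}{2},\ c-a+n,\ 1+a-b+n\end{matrix};\frac1{16}\right]$$ $$-\frac{na(c-a+1)(a-b-c+1)}{(1-b)c(c-a+n)}\;{}_9F_8\left[\begin{matrix}\frac{1-n}{2},\ \frac{2-n}{2},\ 1+\frac{c-a+1}{3},\ a+1,\ a-b+1,\ c-a,\ 1-a,\ b+c-a,\ a-b-c+2\\ \frac32,\ \frac{c-a+1}{3},\ \frac{2-b}{2},\ \frac{3-b}{2},\ \frac{c+1}{2},\ \frac{c+2}{2},\ c-a+n+1,\ a-b+n+1\end{matrix};\frac1{16}\right].$$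
   Context: $(x)_0=1$ and $(x)_n=x(x+1)\cdots(x+n-1)$ for $n\ge1$. The generalized hypergeometric series is ${}_pF_q\left[\begin{matrix}a_1,\dots,a_p\\ b_1,\dots,b_q\end{matrix};z\right]=\sum_{k\ge0}\frac{(a_1)_k\cdots(a_p)_k}{(b_1)_k\cdots(b_q)_k}\frac{z^k}{k!}$, with lower parameters $b_j\in\mathbb{C}\setminus\mathbb{Z}_{\le0}$. The series involved terminate; a term whose coefficient vanishes because of the factor $n$ (when $n=0$) is read as $0$. *)

(* Defs.v *)
From mathcomp Require Import all_boot all_order all_algebra.
From mathcomp Require Import all_classical all_reals all_analysis.
From mathcomp Require Export complex.

Set Implicit Arguments.
Unset Strict Implicit.
Unset Printing Implicit Defensive.

Import Order.TTheory GRing.Theory Num.Theory.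
Import numFieldNormedType.Exports.

Local Open Scope ring_scope.

Definition pochhammer (K : numFieldType) (x : K) (n : nat) : K :=
  \prod_(i < n) (x + i%:R).

Definition nonpos_int (K : numFieldType) (x : K) : Prop :=
  exists m : nat, x = - m%:R.

Definition hypergeometric_term (K : numFieldType) (As Bs : seq K) (z : K)
    (k : nat) : K :=
  (\prod_(x <- As) pochhammer x k) / (\prod_(y <- Bs) pochhammer y k)
  * (z ^+ k / k`!%:R).

(* The topology is the one given by the norm of [K]; for [K := R[i]] it is the
   usual topology of the complex plane.  As for any [limn], the value is
   meaningful only when the series converges, e.g. when it terminates. *)
Definition hypergeometric (K : numFieldType) (As Bs : seq K) (z : K) : K :=
  limn (series (hypergeometric_term As Bs z)).

(* Main.v *)
Require Import Defs.
From mathcomp Require Import all_boot all_order all_algebra.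
From mathcomp Require Import all_classical all_reals all_analysis.
From mathcomp Require Import ring zify.

(** The two series are the even and the odd part of one terminating sum.
    The duplication formula (x)_{2k} = 4^k (x/2)_k ((x+1)/2)_k turns the
    half-integer parameters into binomial coefficients, and the k-th terms
    become

      C(n,2k) (a-b+3k) w_k / ((a-b) (c-a+n)_k (1+a-b+n)_k)      and
      C(n,2k+1) (c-a+1+3k) w_k h_k
        / ((a-b) (1-b+2k) (c+2k) (c-a+n)_{k+1} (1+a-b+n)_k)

    where w_k = [weight] and h_k = [half_step] are free of n.  Let S(n) be the
    sum over k of the differences of these terms.  The product on the left of
    the theorem is 1 at n = 0 and is multiplied by
    (c-a+n) (1+a-b+n) / ((c+n) (1-b+n)) when n increases by one, and S(n)
    satisfies the same recurrence, because

      (c+n) (1-b+n) t_j(n+1) - (c-a+n) (1+a-b+n) t_j(n)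

    telescopes along j, where t_{2k} and t_{2k+1} are the signed even and odd
    terms: a Wilf-Zeilberger pair, whose two-step certificate is [even_flux]
    and [odd_flux] ([even_step], [odd_step]).

    An induction on n from 0 to its actual value would divide by c-a+m for
    m < n, and the hypotheses allow c-a = -m there: only c-a+n and its
    successors are known to be nonzero.  So every term is first multiplied by
    (a-b) and by the products of c-a+i and of 1+a-b+i over n <= i < N, for a
    fixed large N.  This clears the denominators in c-a and a-b, and the
    recurrence becomes (c+n) (1-b+n) S'(n+1) = S'(n) for the new sums S', with
    S'(0) = (a-b) (c-a)_N (1+a-b)_N ([sum_closed]).  At the actual value of n
    the multipliers are nonzero and can be cancelled. *)

Set Implicit Arguments.
Unset Strict Implicit.
Unset Printing Implicit Defensive.

Import Order.TTheory GRing.Theory Num.Theory.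
Import numFieldNormedType.Exports.

Local Open Scope ring_scope.

(** * Shifted factorials *)

Section Pochhammer.
Variable K : numFieldType.
Implicit Types (x z : K) (k m n N : nat).

Lemma pochhammer0 x : pochhammer x 0 = 1.
Proof. by rewrite /pochhammer big_ord0. Qed.

Lemma pochhammerS x k : pochhammer x k.+1 = pochhammer x k * (x + k%:R).
Proof. by rewrite /pochhammer big_ord_recr. Qed.

Lemma pochhammerSl x k : pochhammer x k.+1 = x * pochhammer (x + 1) k.
Proof.
rewrite /pochhammer big_ord_recl /= addr0; congr (_ * _).
by apply: eq_bigr => i _; rewrite /bump /= natrD addrA.
Qed.

Lemma pochhammer_shift x k : pochhammer (1 + x) k * x = pochhammer x k * (x + k%:R).
Proof. by rewrite -pochhammerS pochhammerSl mulrC (addrC 1). Qed.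

Lemma pochhammer_dup x k :
  pochhammer x k.*2 = 4 ^+ k * (pochhammer (x / 2) k * pochhammer ((x + 1) / 2) k).
Proof.
elim: k => [|k IHk]; first by rewrite !pochhammer0 expr0 !mulr1.
rewrite doubleS !pochhammerS IHk exprS -addn1 natrD -mul2n natrM.
by field.
Qed.

Lemma pochhammer_nat m k : m`!%:R * pochhammer (m.+1%:R : K) k = (m + k)`!%:R.
Proof.
elim: k => [|k IHk]; first by rewrite pochhammer0 mulr1 addn0.
by rewrite pochhammerS mulrA IHk addnS factS natrM -natrD addSn mulrC.
Qed.

Lemma pochhammer_opp_nat n k :
  pochhammer (- n%:R : K) k = (-1) ^+ k * (k`!%:R * 'C(n, k)%:R).
Proof.
elim: k => [|k IHk]; first by rewrite pochhammer0 fact0 bin0 !mulr1.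
rewrite pochhammerS IHk exprS factS natrM.
have E : k.+1%:R * 'C(n, k.+1)%:R = (n%:R - k%:R) * 'C(n, k)%:R :> K.
  rewrite -natrM mul_bin_left natrM.
  by have [le|lt] := leqP k n; [rewrite natrB | rewrite bin_small// !mulr0].
rewrite (_ : -1 * _ * _ = - (-1) ^+ k * k`!%:R * (k.+1%:R * 'C(n, k.+1)%:R)).
  by rewrite E; ring.
by ring.
Qed.

Lemma pochhammer_neq0 x k : ~ nonpos_int x -> pochhammer x k != 0.
Proof.
move=> hx; apply/prodf_neq0 => i _; apply/eqP => e.
by apply: hx; exists i; apply/eqP; rewrite -addr_eq0 e.
Qed.

(** For m <= N, the quotient (x)_N / (x)_m, defined also when (x)_m vanishes. *)
Definition segment x m N : K := \prod_(m <= i < N) (x + i%:R).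

Lemma segmentS x m N : (m < N)%N -> segment x m N = (x + m%:R) * segment x m.+1 N.
Proof. by move=> h; rewrite /segment big_ltn. Qed.

Lemma segment_shift x m k N : (m + k <= N)%N ->
  segment x m N = pochhammer (x + m%:R) k * segment x (m + k) N.
Proof.
elim: k => [|k IHk]; first by rewrite pochhammer0 mul1r addn0.
rewrite addnS => h; rewrite IHk ?(ltnW h)// (segmentS _ h) pochhammerS natrD.
by ring.
Qed.

Lemma segment_neq0 x m N : ~ nonpos_int (x + m%:R) -> segment x m N != 0.
Proof.
move=> hx; rewrite /segment prodf_seq_neq0; apply/allP => i.
rewrite mem_index_iota => /andP[mi _]; apply/implyP => _; apply/eqP => e.
by apply: hx; exists (i - m)%N; apply/eqP; rewrite -addr_eq0 -addrA -natrD subnKC// e.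
Qed.

(** The even and the odd nonpositive integers are excluded by the halved
    parameters x/2 and (x+1)/2 respectively. *)
Lemma nonpos_int_half x :
  ~ nonpos_int (x / 2) -> ~ nonpos_int ((x + 1) / 2) -> ~ nonpos_int x.
Proof.
move=> h0 h1 [m hm]; case: (boolP (odd m)) => om.
- apply: h1; exists m./2; rewrite hm -{1}(odd_double_half m) om /= add1n -natr1 -mul2n natrM.
  by field.
- apply: h0; exists m./2; rewrite hm -{1}(odd_double_half m) (negbTE om) add0n -mul2n natrM.
  by field.
Qed.

(** The partial sums of a terminating series are eventually constant, so its
    limit is a finite sum in any Hausdorff topology. *)
Lemma hypergeometric_finite (As Bs : seq K) z n :
  (forall k, (n <= k)%N -> hypergeometric_term As Bs z k = 0) ->
  hypergeometric As Bs z = \sum_(k < n) hypergeometric_term As Bs z k.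
Proof.
move=> h; apply: cvg_lim; first exact: norm_hausdorff.
apply: cvg_near_cst; exists n => // m /= nm.
rewrite /series /= (big_cat_nat (n := n)) //=.
rewrite [X in _ + X]big_nat_cond [X in _ + X]big1 ?addr0 ?big_mkord//.
by move=> i; rewrite andbT => /andP[ni _]; apply: h.
Qed.

End Pochhammer.

(** * The telescoping recurrence *)

Section WZ.
Variables (K : numFieldType) (a b c : K).
Implicit Types (k n N : nat).

Definition weight k : K :=
  pochhammer (a - b) k * pochhammer (c - a) k * pochhammer a k
  * pochhammer (1 - a) k * pochhammer (b + c - a) k
  * pochhammer (a - b - c + 1) k
  / (pochhammer (1 - b) k.*2 * pochhammer c k.*2).

(** The k-th term of the first series times (a-b) and the two products over
    n <= i < N; see [even_termE]. *)
Definition even_term N n k : K :=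
  'C(n, k.*2)%:R * (a - b + 3 * k%:R) * weight k
  * segment (c - a) (n + k) N * segment (1 + a - b) (n + k) N.

(** The factors by which (a-b)_k, (a)_k and (a-b-c+1)_k grow when one passes
    from index 2k to 2k+1 of the interleaved sum; the three other factors of
    [weight] grow from 2k+1 to 2k+2. *)
Definition half_step k : K :=
  (a - b + k%:R) * (a + k%:R) * (a - b - c + 1 + k%:R).

(** The k-th term of the second series, with its coefficient, under the same
    multipliers; see [odd_termE]. *)
Definition odd_term N n k : K :=
  'C(n, k.*2.+1)%:R * (c - a + 1 + 3 * k%:R) * weight k * half_step k
  / ((1 - b + 2 * k%:R) * (c + 2 * k%:R))
  * segment (c - a) (n + k).+1 N * segment (1 + a - b) (n + k) N.

(** The certificate at index 2k, up to sign.  The difference of binomials is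
    C(n,2k-1), written so that it vanishes at k = 0. *)
Definition even_flux N n k : K :=
  ('C(n.+1, k.*2)%:R - 'C(n, k.*2)%:R)
  * (2 * k%:R - b) * (c + 2 * k%:R - 1) * weight k
  * segment (c - a) (n + k).+1 N * segment (1 + a - b) (n + k) N.

(** The certificate at index 2k+1. *)
Definition odd_flux N n k : K :=
  'C(n, k.*2)%:R * weight k * half_step k
  * segment (c - a) (n + k).+1 N * segment (1 + a - b) (n + k).+1 N.

Lemma bin_ratio n j :
  (n%:R + 1 - j%:R) * 'C(n.+1, j)%:R = (n%:R + 1) * 'C(n, j)%:R :> K.
Proof.
have [le|lt] := leqP j n.+1; last first.
  by rewrite !bin_small ?mulr0// ltnW.
by rewrite natr1 -natrB// -!natrM -mul_bin_down.
Qed.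

(** After division by the common factors both sides are linear in u = C(n,2k)
    and v = C(n+1,2k), and their difference is a polynomial multiple of the
    relation (n+1-2k) v = (n+1) u. *)
Lemma even_step N n k : (n + k < N)%N ->
  (c + n%:R) * (1 - b + n%:R) * even_term N n.+1 k - even_term N n k
  = odd_flux N n k + even_flux N n k.
Proof.
move=> h; have := bin_ratio n k.*2.
rewrite /even_term /odd_flux /even_flux /half_step !addSn !(segmentS _ h).
rewrite -muln2 natrM natrD.
set u := 'C(n, _)%:R; set v := 'C(n.+1, _)%:R => e.
apply/eqP; rewrite -subr_eq0; apply/eqP.
set Y := segment _ _ _; set X := segment _ _ _.
(* With s = n-z, where z = 2k-1 is the previous index, the coefficient of v
   is (a-b+3k) (c+z+s) (1-b+z+s) - (a-b+3k+s) (c+z) (1-b+z); the middle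
   factor below is its quotient by s. *)
transitivity (weight k * Y * X *
  ((a - b + 3 * k%:R) * (c + 1 - b + 2 * (2 * k%:R - 1) + (n%:R + 1 - 2 * k%:R))
    - (c + 2 * k%:R - 1) * (2 * k%:R - b)) *
  ((n%:R + 1 - k%:R * 2) * v - (n%:R + 1) * u)); last by rewrite e subrr mulr0.
by ring.
Qed.

Hypothesis hb : forall k, pochhammer (1 - b) k != 0.
Hypothesis hc : forall k, pochhammer c k != 0.

Lemma shifted_b_neq0 k : 1 - b + k%:R != 0.
Proof. by have := hb k.+1; rewrite pochhammerS mulf_eq0 negb_or => /andP[]. Qed.
Lemma shifted_c_neq0 k : c + k%:R != 0.
Proof. by have := hc k.+1; rewrite pochhammerS mulf_eq0 negb_or => /andP[]. Qed.

Lemma weightS k : weight k.+1 =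
  weight k * half_step k * ((c - a + k%:R) * (1 - a + k%:R) * (b + c - a + k%:R))
  / ((1 - b + 2 * k%:R) * (c + 2 * k%:R)
     * ((1 - b + 2 * k%:R + 1) * (c + 2 * k%:R + 1))).
Proof.
rewrite /weight /half_step doubleS !pochhammerS.
have := shifted_b_neq0 k.*2; have := shifted_b_neq0 k.*2.+1.
have := shifted_c_neq0 k.*2; have := shifted_c_neq0 k.*2.+1.
rewrite -!natr1 -muln2 natrM !addrA (mulrC k%:R) => h1 h2 h3 h4.
have h5 := hb (k * 2); have h6 := hc (k * 2).
by field; rewrite h5 h6 h4 h2 h3 h1.
Qed.

(** As for [even_step], now with u = C(n,2k+1) and v = C(n+1,2k+1): Pascal's
    rule expresses the binomial coefficients in the two fluxes as v - u and u. *)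
Lemma odd_step N n k : (n + k.+1 < N)%N ->
  (c + n%:R) * (1 - b + n%:R) * odd_term N n.+1 k - odd_term N n k
  = odd_flux N n k + even_flux N n k.+1.
Proof.
move=> h; have := bin_ratio n k.*2.+1.
have hn : (n + k < N)%N by lia.
rewrite addnS in h.
rewrite /odd_term /odd_flux /even_flux !addSn !addnS weightS.
rewrite (segmentS (1 + a - b) hn) !(segmentS (c - a) h).
rewrite (_ : 'C(n.+1, k.+1.*2)%:R - 'C(n, k.+1.*2)%:R = 'C(n, k.*2.+1)%:R); last first.
  by rewrite doubleS binS natrD addrC addKr.
rewrite (_ : 'C(n, k.*2)%:R = 'C(n.+1, k.*2.+1)%:R - 'C(n, k.*2.+1)%:R); last first.
  by rewrite binS natrD addrC addKr.
have := shifted_b_neq0 k.*2; have := shifted_b_neq0 k.*2.+1.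
have := shifted_c_neq0 k.*2; have := shifted_c_neq0 k.*2.+1.
set u := 'C(n, _)%:R; set v := 'C(n.+1, _)%:R.
rewrite -!natr1 -muln2 natrM (natrD _ n k) !addrA (mulrC k%:R) => h1 h2 h3 h4 e.
apply/eqP; rewrite -subr_eq0; apply/eqP.
set Y := segment _ _ _; set X := segment _ _ _.
(* The same quotient with z = 2k and c-a+1+3k in place of a-b+3k. *)
transitivity (weight k * half_step k / ((1 - b + 2 * k%:R) * (c + 2 * k%:R)) * Y * X *
  ((c - a + 1 + 3 * k%:R) * (c + 1 - b + 2 * (2 * k%:R) + (n%:R - 2 * k%:R))
    - (c + 2 * k%:R) * (1 - b + 2 * k%:R)) *
  ((n%:R + 1 - (2 * k%:R + 1)) * v - (n%:R + 1) * u)); last first.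
  by rewrite -e subrr mulr0.
by field; rewrite h4 h2 h3 h1.
Qed.

(** The flux leaving through index 2k+1 cancels within a pair of terms; the
    flux at k = M vanishes because 2M > n+1. *)
Lemma sum_step N n M : (n < M)%N -> (n + M < N)%N ->
  (c + n%:R) * (1 - b + n%:R)
    * \sum_(k < M) (even_term N n.+1 k - odd_term N n.+1 k)
  = \sum_(k < M) (even_term N n k - odd_term N n k).
Proof.
move=> nM hN; apply/eqP; rewrite -subr_eq0 mulr_sumr -sumrB; apply/eqP.
transitivity (\sum_(k < M) (even_flux N n k - even_flux N n k.+1)).
  apply: eq_bigr => k _; have kM := ltn_ord k.
  have e := @even_step N n k ltac:(lia); have o := @odd_step N n k ltac:(lia).
  transitivity ((odd_flux N n k + even_flux N n k)
                - (odd_flux N n k + even_flux N n k.+1)); last by ring.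
  by rewrite -e -o; ring.
rewrite -(big_mkord xpredT (fun k => even_flux N n k - even_flux N n k.+1)).
under eq_bigr do rewrite -opprB.
rewrite sumrN telescope_sumr// /even_flux double0 !bin0 subrr !mul0r subr0.
have [h1 h2] : (n.+1 < M.*2)%N /\ (n < M.*2)%N by rewrite -addnn; lia.
by rewrite !bin_small// subrr !mul0r oppr0.
Qed.

Lemma sum_closed N n M : (n <= M)%N -> (0 < M)%N -> (n + M <= N)%N ->
  pochhammer c n * pochhammer (1 - b) n
    * \sum_(k < M) (even_term N n k - odd_term N n k)
  = (a - b) * segment (c - a) 0 N * segment (1 + a - b) 0 N.
Proof.
move=> + M0; elim: n => [_ _|n IHn nM hN]; last first.
  rewrite -IHn; [|lia|lia]; rewrite -(@sum_step N n M); [|lia|lia].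
  by rewrite !pochhammerS; ring.
rewrite !pochhammer0 !mul1r; case: M M0 => // M _.
rewrite big_ord_recl big1 => [|i _].
  rewrite /even_term /odd_term /weight double0 bin0 bin_small// !pochhammer0.
  by rewrite add0n !mulr1 !mul1r invr1 !mul0r mulr0 addr0 subr0 addr0 mulr1.
by rewrite /even_term /odd_term !bin_small ?lift0 ?doubleS// !mul0r subrr.
Qed.

End WZ.

(** * The summands as hypergeometric terms *)

Section Conversion.
Variable K : numFieldType.
Implicit Types (x : K) (k n N : nat).

Lemma fact_pochhammer k : k`!%:R = pochhammer 1 k :> K.
Proof. by have := pochhammer_nat K 0 k; rewrite fact0 mul1r add0n. Qed.

Lemma pow4_neq0 k : (4 : K) ^+ k != 0.
Proof. by rewrite expf_neq0// pnatr_eq0. Qed.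

(** (-n)_{2k} = C(n,2k) (2k)!, split by the duplication formula on both
    sides. *)
Lemma bin_even n k :
  'C(n, k.*2)%:R * (pochhammer (1 / 2) k * k`!%:R)
  = pochhammer (- (n%:R / 2)) k * pochhammer ((1 - n%:R) / 2) k :> K.
Proof.
apply: (mulfI (pow4_neq0 k)).
rewrite mulrCA fact_pochhammer.
have -> : pochhammer 1 k = pochhammer ((1 + 1) / 2) k :> K.
  by congr pochhammer; field.
rewrite -pochhammer_dup -fact_pochhammer.
have -> : - (n%:R / 2) = (- n%:R) / 2 :> K by rewrite mulNr.
rewrite (addrC 1) -pochhammer_dup pochhammer_opp_nat.
by rewrite -signr_odd odd_double mul1r mulrC.
Qed.

(** n (1-n)_{2k} = C(n,2k+1) (2k+1)!, split by the duplication formula, with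
    (2k+1)! = (2)_{2k}. *)
Lemma bin_odd n k :
  'C(n, k.*2.+1)%:R * (pochhammer (3 / 2) k * k`!%:R)
  = n%:R * (pochhammer ((1 - n%:R) / 2) k * pochhammer ((2 - n%:R) / 2) k) :> K.
Proof.
case: n => [|n]; first by rewrite bin0n !mul0r.
apply: (mulfI (pow4_neq0 k)).
rewrite mulrCA [RHS]mulrCA.
rewrite (_ : (1 - n.+1%:R) / 2 = (- n%:R) / 2); last by rewrite -natr1; field.
rewrite (_ : (2 - n.+1%:R) / 2 = (- n%:R + 1) / 2); last by rewrite -natr1; field.
rewrite -pochhammer_dup pochhammer_opp_nat -signr_odd odd_double mul1r.
have -> : 4 ^+ k * (pochhammer (3 / 2) k * k`!%:R) = k.*2.+1`!%:R :> K.
  rewrite -[RHS](pochhammer_nat K 1 k.*2) mul1r pochhammer_dup fact_pochhammer.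
  rewrite (mulrC (pochhammer (3 / 2) k)).
  by congr (_ * (pochhammer _ k * pochhammer _ k)); field.
by rewrite -!natrM factS mulnCA mulnA -(mul_bin_diag n.+1) -mulnA (mulnC 'C(_, _)).
Qed.

Variables (a b c : K).

(** (1+(a-b)/3)_k / ((a-b)/3)_k = (a-b+3k)/(a-b) produces the linear factor,
    and the powers of 4 from the duplication formula, for 1-b and c,
    account for (1/16)^k. *)
Lemma even_termE N n k :
  (n + k <= N)%N ->
  (forall y : K,
     y \in [:: 1 / 2; (a - b) / 3; (1 - b) / 2; (2 - b) / 2; c / 2;
               (c + 1) / 2; c - a + n%:R; 1 + a - b + n%:R] ->
     ~ nonpos_int y) ->
  even_term a b c N n k =
  (a - b) * segment (c - a) n N * segment (1 + a - b) n N *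
  hypergeometric_term
      [:: - (n%:R / 2); (1 - n%:R) / 2; 1 + (a - b) / 3; a - b; c - a; a;
          1 - a; b + c - a; a - b - c + 1]
      [:: 1 / 2; (a - b) / 3; (1 - b) / 2; (2 - b) / 2; c / 2;
          (c + 1) / 2; c - a + n%:R; 1 + a - b + n%:R]
      (1 / 16) k.
Proof.
move=> hN h; rewrite /even_term /weight /hypergeometric_term !big_cons !big_nil.
have nz y : y \in _ -> pochhammer y k != 0 := fun hy => pochhammer_neq0 k (h y hy).
have h1 := nz (1 / 2) ltac:(by rewrite !inE eqxx).
have h2 := nz ((a - b) / 3) ltac:(by rewrite !inE eqxx ?orbT).
have h3 := nz ((1 - b) / 2) ltac:(by rewrite !inE eqxx ?orbT).
have h4 := nz ((2 - b) / 2) ltac:(by rewrite !inE eqxx ?orbT).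
have h5 := nz (c / 2) ltac:(by rewrite !inE eqxx ?orbT).
have h6 := nz ((c + 1) / 2) ltac:(by rewrite !inE eqxx ?orbT).
have h7 := nz (c - a + n%:R) ltac:(by rewrite !inE eqxx ?orbT).
have h8 := nz (1 + a - b + n%:R) ltac:(by rewrite !inE eqxx ?orbT).
have ab0 : a - b != 0.
  apply/eqP => e; apply: (h ((a - b) / 3)); first by rewrite !inE eqxx ?orbT.
  by exists 0%N; rewrite e mul0r oppr0.
have kf : k`!%:R != 0 :> K by rewrite pnatr_eq0 -lt0n fact_gt0.
have p4 := pow4_neq0 k.
rewrite (segment_shift (c - a) hN) (segment_shift (1 + a - b) hN).
rewrite (_ : pochhammer (1 + (a - b) / 3) k
  = pochhammer ((a - b) / 3) k * (a - b + 3 * k%:R) / (a - b)); last first.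
  have e := pochhammer_shift ((a - b) / 3) k.
  apply: (mulIf (_ : (a - b) / 3 != 0)); first by rewrite mulf_neq0 ?invr_eq0 ?pnatr_eq0.
  by rewrite e; field.
rewrite !pochhammer_dup (_ : (1 - b + 1) / 2 = (2 - b) / 2); last by congr (_ / 2); ring.
rewrite expr_div_n expr1n (_ : 16 = 4 ^+ 2 :> K); last by rewrite -natrX.
rewrite -exprM mulnC exprM.
rewrite (_ : 'C(n, k.*2)%:R = pochhammer (- (n%:R / 2)) k * pochhammer ((1 - n%:R) / 2) k
   / (pochhammer (1 / 2) k * k`!%:R)); last first.
  by rewrite -bin_even mulfK// mulf_neq0.
move: h1 h2 h3 h4 h5 h6 h7 h8 p4 kf.
move: (pochhammer (1 / 2) k) => P1.
move: (pochhammer ((a - b) / 3) k) => P2.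
move: (pochhammer ((1 - b) / 2) k) => P3.
move: (pochhammer ((2 - b) / 2) k) => P4.
move: (pochhammer (c / 2) k) => P5.
move: (pochhammer ((c + 1) / 2) k) => P6.
move: (pochhammer (c - a + n%:R) k) => P7.
move: (pochhammer (1 + a - b + n%:R) k) => P8.
move: (4 ^+ k) (k`!%:R) => p4 kf *.
by field; do ?[apply/andP; split].
Qed.

Lemma odd_termE N n k :
  (n + k < N)%N ->
  (forall y : K,
     y \in [:: 3 / 2; (c - a + 1) / 3; (2 - b) / 2; (3 - b) / 2; (c + 1) / 2;
               (c + 2) / 2; c - a + n%:R + 1; a - b + n%:R + 1] ->
     ~ nonpos_int y) ->
  (1 - b) * c * (c - a + n%:R) <> 0 ->
  odd_term a b c N n k =
  (a - b) * segment (c - a) n N * segment (1 + a - b) n N *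
  (n%:R * a * (c - a + 1) * (a - b - c + 1)
      / ((1 - b) * c * (c - a + n%:R)) *
  hypergeometric_term
        [:: (1 - n%:R) / 2; (2 - n%:R) / 2; 1 + (c - a + 1) / 3; a + 1;
            a - b + 1; c - a; 1 - a; b + c - a; a - b - c + 2]
        [:: 3 / 2; (c - a + 1) / 3; (2 - b) / 2; (3 - b) / 2; (c + 1) / 2;
            (c + 2) / 2; c - a + n%:R + 1; a - b + n%:R + 1]
        (1 / 16) k).
Proof.
move=> hN h /eqP; have nN : (n < N)%N by apply: leq_ltn_trans hN; apply: leq_addr.
rewrite !mulf_eq0 !negb_or => /andP[/andP[b0 c0] can0].
rewrite /hypergeometric_term !big_cons !big_nil.
have nz y : y \in _ -> pochhammer y k != 0 := fun hy => pochhammer_neq0 k (h y hy).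
have h1 := nz (3 / 2) ltac:(by rewrite !inE eqxx).
have h2 := nz ((c - a + 1) / 3) ltac:(by rewrite !inE eqxx ?orbT).
have h3 := nz ((2 - b) / 2) ltac:(by rewrite !inE eqxx ?orbT).
have h4 := nz ((3 - b) / 2) ltac:(by rewrite !inE eqxx ?orbT).
have h5 := nz ((c + 1) / 2) ltac:(by rewrite !inE eqxx ?orbT).
have h6 := nz ((c + 2) / 2) ltac:(by rewrite !inE eqxx ?orbT).
have h7 := nz (c - a + n%:R + 1) ltac:(by rewrite !inE eqxx ?orbT).
have h8 := nz (a - b + n%:R + 1) ltac:(by rewrite !inE eqxx ?orbT).
have ca0 : c - a + 1 != 0.
  apply/eqP => e; apply: (h ((c - a + 1) / 3)); first by rewrite !inE eqxx ?orbT.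
  by exists 0%N; rewrite e mul0r oppr0.
have kf : k`!%:R != 0 :> K by rewrite pnatr_eq0 -lt0n fact_gt0.
have p4 := pow4_neq0 k.
(* The odd part in terms of parameters shifted by one: (x)_k (x+k) is
   x (x+1)_k for a, a-b and a-b-c+1, and the two denominators absorb 1-b+2k
   and c+2k in the same way. *)
have weightE : weight a b c k * half_step a b c k
    / ((1 - b + 2 * k%:R) * (c + 2 * k%:R))
  = a * (a - b) * (a - b - c + 1) / ((1 - b) * c)
    * (pochhammer (a + 1) k * pochhammer (a - b + 1) k * pochhammer (c - a) k
       * pochhammer (1 - a) k * pochhammer (b + c - a) k
       * pochhammer (a - b - c + 2) k)
    / (4 ^+ k * pochhammer ((2 - b) / 2) k * pochhammer ((3 - b) / 2) k
       * (4 ^+ k * pochhammer ((c + 1) / 2) k * pochhammer ((c + 2) / 2) k)).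
  have eb : pochhammer (1 - b) k.*2 * (1 - b + 2 * k%:R)
    = (1 - b) * (4 ^+ k * pochhammer ((2 - b) / 2) k * pochhammer ((3 - b) / 2) k).
    rewrite -natrM mul2n -pochhammerS pochhammerSl pochhammer_dup -(mulrA (4 ^+ k)).
    rewrite (_ : 1 - b + 1 = 2 - b); last by ring.
    by rewrite (_ : 2 - b + 1 = 3 - b); last by ring.
  have ec : pochhammer c k.*2 * (c + 2 * k%:R)
    = c * (4 ^+ k * pochhammer ((c + 1) / 2) k * pochhammer ((c + 2) / 2) k).
    rewrite -natrM mul2n -pochhammerS pochhammerSl pochhammer_dup -(mulrA (4 ^+ k)).
    by rewrite (_ : c + 1 + 1 = c + 2); last by ring.
  have ex := pochhammer_shift (a - b) k.
  have ea := pochhammer_shift a k.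
  have ew := pochhammer_shift (a - b - c + 1) k.
  rewrite (_ : 1 + (a - b - c + 1) = a - b - c + 2) in ew; last by ring.
  rewrite (addrC a 1) (addrC (a - b) 1).
  transitivity ((pochhammer (a - b) k * (a - b + k%:R)) * (pochhammer a k * (a + k%:R))
     * (pochhammer (a - b - c + 1) k * (a - b - c + 1 + k%:R))
     * (pochhammer (c - a) k * pochhammer (1 - a) k * pochhammer (b + c - a) k)
     / ((pochhammer (1 - b) k.*2 * (1 - b + 2 * k%:R))
     * (pochhammer c k.*2 * (c + 2 * k%:R)))).
    by rewrite /weight /half_step !invfM; ring.
  by rewrite eb ec -ex -ea -ew !invfM; ring.
rewrite /odd_term.
transitivity ('C(n, k.*2.+1)%:R * (c - a + 1 + 3 * k%:R)
  * (weight a b c k * half_step a b c k / ((1 - b + 2 * k%:R) * (c + 2 * k%:R)))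
  * segment (c - a) (n + k).+1 N * segment (1 + a - b) (n + k) N); first by ring.
rewrite weightE.
rewrite (segmentS _ nN) (@segment_shift _ (c - a) n.+1 k N hN) (segment_shift (1 + a - b) (ltnW hN)).
rewrite -[n.+1%:R]natr1 (addrA (c - a)) (_ : 1 + a - b + n%:R = a - b + n%:R + 1); last by ring.
rewrite (_ : pochhammer (1 + (c - a + 1) / 3) k
  = pochhammer ((c - a + 1) / 3) k * (c - a + 1 + 3 * k%:R) / (c - a + 1)); last first.
  have e := pochhammer_shift ((c - a + 1) / 3) k.
  apply: (mulIf (_ : (c - a + 1) / 3 != 0)); first by rewrite mulf_neq0 ?invr_eq0 ?pnatr_eq0.
  by rewrite e; field.
rewrite expr_div_n expr1n (_ : 16 = 4 ^+ 2 :> K); last by rewrite -natrX.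
rewrite -exprM mulnC exprM addSn.
rewrite (_ : 'C(n, k.*2.+1)%:R
   = n%:R * (pochhammer ((1 - n%:R) / 2) k * pochhammer ((2 - n%:R) / 2) k)
   / (pochhammer (3 / 2) k * k`!%:R)); last first.
  by rewrite -bin_odd mulfK// mulf_neq0.
move: h1 h2 h3 h4 h5 h6 h7 h8 p4 kf.
move: (pochhammer (3 / 2) k) => P1.
move: (pochhammer ((c - a + 1) / 3) k) => P2.
move: (pochhammer ((2 - b) / 2) k) => P3.
move: (pochhammer ((3 - b) / 2) k) => P4.
move: (pochhammer ((c + 1) / 2) k) => P5.
move: (pochhammer ((c + 2) / 2) k) => P6.
move: (pochhammer (c - a + n%:R + 1) k) => P7.
move: (pochhammer (a - b + n%:R + 1) k) => P8.
move: (4 ^+ k) (k`!%:R) => p4 kf *.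
by field; do ?[apply/andP; split].
Qed.

Lemma hypergeometric_term_eq0 (As Bs : seq K) z k m :
  - m%:R \in As -> (m < k)%N -> hypergeometric_term As Bs z k = 0.
Proof.
move=> hm mk; rewrite /hypergeometric_term (big_rem _ hm) /=.
suff -> : pochhammer (- m%:R : K) k = 0 by rewrite !mul0r.
by rewrite /pochhammer (bigD1 (Ordinal mk)) //= addNr mul0r.
Qed.

End Conversion.

(** * The summation formula *)

Local Open Scope complex_scope.

Theorem theorem4p4 (R : realType) (n : nat) (a b c : R[i])
  (lower1 : forall y : R[i],
     y \in [:: 1 / 2; (a - b) / 3; (1 - b) / 2; (2 - b) / 2; c / 2;
               (c + 1) / 2; c - a + n%:R; 1 + a - b + n%:R] ->
     ~ nonpos_int y)
  (lower2 : forall y : R[i],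
     y \in [:: 3 / 2; (c - a + 1) / 3; (2 - b) / 2; (3 - b) / 2; (c + 1) / 2;
               (c + 2) / 2; c - a + n%:R + 1; a - b + n%:R + 1] ->
     ~ nonpos_int y)
  (denom_lhs : pochhammer c n * pochhammer (1 - b) n <> 0)
  (denom_rhs : (1 - b) * c * (c - a + n%:R) <> 0) :
  pochhammer (c - a) n * pochhammer (a - b + 1) n
    / (pochhammer c n * pochhammer (1 - b) n)
  = hypergeometric
      [:: - (n%:R / 2); (1 - n%:R) / 2; 1 + (a - b) / 3; a - b; c - a; a;
          1 - a; b + c - a; a - b - c + 1]
      [:: 1 / 2; (a - b) / 3; (1 - b) / 2; (2 - b) / 2; c / 2;
          (c + 1) / 2; c - a + n%:R; 1 + a - b + n%:R]
      (1 / 16)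
  - n%:R * a * (c - a + 1) * (a - b - c + 1)
      / ((1 - b) * c * (c - a + n%:R))
    * hypergeometric
        [:: (1 - n%:R) / 2; (2 - n%:R) / 2; 1 + (c - a + 1) / 3; a + 1;
            a - b + 1; c - a; 1 - a; b + c - a; a - b - c + 2]
        [:: 3 / 2; (c - a + 1) / 3; (2 - b) / 2; (3 - b) / 2; (c + 1) / 2;
            (c + 2) / 2; c - a + n%:R + 1; a - b + n%:R + 1]
        (1 / 16).
Proof.
have hb k : pochhammer (1 - b) k != 0.
  apply: (pochhammer_neq0 k (nonpos_int_half (lower1 ((1 - b) / 2) _)
           (lower1 ((1 - b + 1) / 2) _))); first by rewrite !inE eqxx ?orbT.
  by rewrite (_ : 1 - b + 1 = 2 - b) ?inE ?eqxx ?orbT//; ring.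
have hc k : pochhammer c k != 0.
  by apply: (pochhammer_neq0 k (nonpos_int_half (lower1 (c / 2) _)
       (lower1 ((c + 1) / 2) _))); rewrite !inE eqxx ?orbT.
have ab0 : a - b != 0.
  apply/eqP => e; apply: (lower1 ((a - b) / 3)); first by rewrite !inE eqxx ?orbT.
  by exists 0%N; rewrite e mul0r oppr0.
(* The segments in the terms with k <= n start at n+k+1 <= 2n+1 at the latest. *)
pose N := (n + n.+1)%N.
have y0 : segment (c - a) n N != 0.
  by apply: segment_neq0; apply: lower1; rewrite !inE eqxx ?orbT.
have x0 : segment (1 + a - b) n N != 0.
  by apply: segment_neq0; apply: lower1; rewrite !inE eqxx ?orbT.
have N1 (k : 'I_n.+1) : (n + k <= N)%N by rewrite leq_add2l ltnW.
have N2 (k : 'I_n.+1) : (n + k < N)%N by rewrite ltn_add2l.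
have half m : - (m.*2%:R / 2) = - m%:R :> R[i].
  by rewrite -mul2n natrM; field.
rewrite (@hypergeometric_finite _ _ _ _ n.+1); last first.
  move=> k nk; apply: (@hypergeometric_term_eq0 _ _ _ _ _ n./2); last by lia.
  have := odd_double_half n; case: (odd n) => /= e; rewrite !inE -half -{2 4}e.
    by rewrite orbC -orbA; apply/orP; left; apply/eqP; rewrite add1n -natr1; field.
  by rewrite add0n eqxx.
set S1 := \sum_(k < n.+1) _; set H2 := hypergeometric _ _ _; set kap := n%:R * a * _ * _ / _.
have kapH : kap * H2 = \sum_(k < n.+1) kap * hypergeometric_term
        [:: (1 - n%:R) / 2; (2 - n%:R) / 2; 1 + (c - a + 1) / 3; a + 1;
            a - b + 1; c - a; 1 - a; b + c - a; a - b - c + 2]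
        [:: 3 / 2; (c - a + 1) / 3; (2 - b) / 2; (3 - b) / 2; (c + 1) / 2;
            (c + 2) / 2; c - a + n%:R + 1; a - b + n%:R + 1]
        (1 / 16) k.
  (* For n = 0 the second series need not terminate, but its coefficient is 0. *)
  have [n0|n0] := posnP n.
    have -> : kap = 0 by rewrite /kap n0 !mul0r.
    by rewrite mul0r big1// => k _; rewrite mul0r.
  rewrite -mulr_sumr; congr (_ * _); apply: hypergeometric_finite => k nk.
  apply: (@hypergeometric_term_eq0 _ _ _ _ _ n.-1./2); last by lia.
  have := odd_double_half n.-1; case: (odd n.-1) => /= e; rewrite !inE -half.
    apply/orP; right; apply/orP; left; apply/eqP.
    by rewrite -(prednK n0) -{2}e add1n -!natr1; field.
  by apply/orP; left; apply/eqP; rewrite -(prednK n0) -{2}e add0n -natr1; field.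
rewrite kapH.
set S2 := \sum_(k < n.+1) _.
have evenE : \sum_(k < n.+1) even_term a b c N n k
    = (a - b) * segment (c - a) n N * segment (1 + a - b) n N * S1.
  by rewrite mulr_sumr; apply: eq_bigr => k _; rewrite (even_termE (N1 k) lower1).
have oddE : \sum_(k < n.+1) odd_term a b c N n k
    = (a - b) * segment (c - a) n N * segment (1 + a - b) n N * S2.
  rewrite mulr_sumr; apply: eq_bigr => k _.
  by rewrite (odd_termE (N2 k) lower2 denom_rhs).
have := sum_closed a hb hc (leqnSn n) (ltn0Sn n) (leqnn N).
have nN : (0 + n <= N)%N by rewrite leq_addr.
rewrite sumrB evenE oddE !(segment_shift _ nN) add0n !addr0.
rewrite (_ : a - b + 1 = 1 + a - b); last by ring.
move: (segment _ _ _) (segment _ _ _) y0 x0 => Y X Y0 X0 key.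
apply: (mulfI (mulf_neq0 (mulf_neq0 ab0 Y0) X0)).
rewrite mulrBr mulrA; apply: (canLR (mulfK _)); first exact/eqP.
by rewrite [RHS]mulrC key; ring.
Qed.
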